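(* Let $X>0$, $n\ge1$, let $a_0,a_1$ be $X$-periodic $\mathbb{C}^{n\times n}$-valued functions in $H^1_{\rm per}([0,X])$, and for $\sigma\in[0,2\pi)$ let $A_1=a_1+2i\sigma I$, $A_0=a_0-\sigma^2I+i\sigma a_1$, $K(\sigma,\lambda)=\partial_x(\partial_x^2-1)^{-1}A_1+(\partial_x^2-1)^{-1}(A_0+(1-\lambda)I)$ on $L^2_{\rm per}([0,X];\mathbb{C}^n)$. Let $D_\sigma(\lambda)={\det}_2(I+K(\sigma,\lambda))$ and $D_{\sigma,J}(\lambda)={\det}_2(I+P_JK(\sigma,\lambda)P_J|_{\mathcal{H}_J})$, where $P_J$ is the orthogonal projection onto $\mathcal{H}_J=\operatorname{span}\{e^{2\pi ikx/X}v:|k|\le J, v\in\mathbb{C}^n\}$. Then for each $R>0$ there exists $C=C(R)>0$ such that $|D_{\sigma,J}(\lambda)-D_\sigma(\lambda)|\le CJ^{-1/2}$ for all $J\in\mathbb{N}$, all $|\lambda|\le R$ and all $\sigma\in[0,2\pi)$.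
   Context: The multipliers act diagonally on Fourier modes. ${\det}_2$ is the 2-modified Fredholm determinant: ${\det}_2(I-A)=\det(I-A)e^{\operatorname{tr}A}$ in finite dimension, and for Hilbert–Schmidt $A$ the limit of ${\det}_2$ of finite-dimensional compressions along increasing subspaces with dense union; ${\det}_2(I+K)$ means ${\det}_2(I-(-K))$. *)

(* Defs.v *)
From HB Require Import structures.
From mathcomp Require Import all_boot all_order all_algebra.
From mathcomp Require Import all_classical all_reals all_analysis.
From mathcomp Require Import complex.
Set Implicit Arguments. Unset Strict Implicit. Unset Printing Implicit Defensive.
Import Order.TTheory GRing.Theory Num.Theory.
Local Open Scope ring_scope.
Local Open Scope classical_set_scope.

Definition cabs (R : realType) (z : R[i]) : R := Normc.normc z.

Definition cexp (R : realType) (z : R[i]) : R[i] :=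
  Complex (expR (complex.Re z) * cos (complex.Im z)) (expR (complex.Re z) * sin (complex.Im z)).

Definition xi (R : realType) (X : R) (k : int) : R := 2 * pi * k%:~R / X.

(* Fourier coefficient  (1/X) int_0^X f(x) e^{-2 pi i k x/X} dx  (real and imaginary
   parts computed as real Lebesgue integrals) *)
Definition fcoef (R : realType) (X : R) (f : R -> R[i]) (k : int) : R[i] :=
  Complex (X^-1 * Rintegral lebesgue_measure `[0, X]
      (fun x => complex.Re (f x) * cos (xi X k * x) + complex.Im (f x) * sin (xi X k * x)))
  (X^-1 * Rintegral lebesgue_measure `[0, X]
      (fun x => complex.Im (f x) * cos (xi X k * x) - complex.Re (f x) * sin (xi X k * x))).

(* the integer k = p - J for p : 'I_(2J+1), i.e. k ranges over -J..J *)
Definition idxJ (J : nat) (p : 'I_(2 * J + 1)) : int := (p%:Z - J%:Z)%R.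

(* f : R -> C is X-periodic and in H^1_per([0,X]): locally integrable with
   sum_k (1 + xi_k^2) |hat f(k)|^2 < oo *)
Definition H1per (R : realType) (X : R) (f : R -> R[i]) : Prop :=
  [/\ forall x, f (x + X) = f x,
      (lebesgue_measure).-integrable `[0, X] (fun x => (complex.Re (f x))%:E),
      (lebesgue_measure).-integrable `[0, X] (fun x => (complex.Im (f x))%:E)
    & exists M : R, forall J : nat,
        \sum_(p < 2 * J + 1) (1 + xi X (idxJ p) ^+ 2) * cabs (fcoef X f (idxJ p)) ^+ 2 <= M].

Definition H1per_mx (R : realType) (n : nat) (X : R) (a : R -> 'M[R[i]]_n) : Prop :=
  forall i j, H1per X (fun x => a x i j).

(* Fourier symbols: d/dx acts on e_k by i xi_k, (d^2/dx^2 - 1)^{-1} by ((i xi_k)^2 - 1)^{-1} *)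
Definition sym_dx (R : realType) (X : R) (k : int) : R[i] := Complex 0 (xi X k).
Definition sym_res (R : realType) (X : R) (k : int) : R[i] := (sym_dx X k ^+ 2 - 1)^-1.

Definition A1 (R : realType) (n : nat) (a1 : R -> 'M[R[i]]_n) (s : R) (x : R) : 'M[R[i]]_n :=
  a1 x + (2 * 'i * (Complex s 0))%:M.
Definition A0 (R : realType) (n : nat) (a0 a1 : R -> 'M[R[i]]_n) (s : R) (x : R) : 'M[R[i]]_n :=
  a0 x - ((Complex s 0) ^+ 2)%:M + ('i * (Complex s 0)) *: a1 x.

(* Matrix entries of K(sigma,lambda) = d_x (d_x^2-1)^{-1} A_1 + (d_x^2-1)^{-1}(A_0 + (1-lambda) I)
   on L^2_per([0,X];C^n) in the orthonormal basis X^{-1/2} e^{2 pi i k x/X} v_j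
   (v_j standard basis of C^n): entry ((k,i),(m,j)) = <basis(k,i), K basis(m,j)>.
   Multiplication by a matrix function b acts as convolution with its Fourier coefficients. *)
Definition Kentry (R : realType) (n : nat) (X : R) (a0 a1 : R -> 'M[R[i]]_n) (s : R) (lam : R[i])
  (ki mj : int * 'I_n) : R[i] :=
  let: (k, i) := ki in let: (m, j) := mj in
  sym_dx X k * sym_res X k * fcoef X (fun x => A1 a1 s x i j) (k - m)
  + sym_res X k * fcoef X (fun x => (A0 a0 a1 s x + (1 - lam)%:M) i j) (k - m).

Definition detF (R : realType) (T : finType) (M : T -> T -> R[i]) : R[i] :=
  \det (\matrix_(p < #|T|, q < #|T|) M (enum_val p) (enum_val q)).
Definition trF (R : realType) (T : finType) (M : T -> T -> R[i]) : R[i] :=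
  \sum_(a : T) M a a.

Definition det2_IplusF (R : realType) (T : finType) (M : T -> T -> R[i]) : R[i] :=
  detF (fun a b => (a == b)%:R + M a b) * cexp (- trF M).

(* compression P_J K P_J |_{H_J} of an operator given by its matrix in the Fourier basis;
   H_J = span{ e^{2 pi i k x/X} v : |k| <= J } *)
Definition compress (R : realType) (n J : nat) (K : int * 'I_n -> int * 'I_n -> R[i])
  : 'I_(2 * J + 1) * 'I_n -> 'I_(2 * J + 1) * 'I_n -> R[i] :=
  fun a b => K (idxJ a.1, a.2) (idxJ b.1, b.2).

Definition det2_trunc (R : realType) (n J : nat) (K : int * 'I_n -> int * 'I_n -> R[i]) : R[i] :=
  det2_IplusF (@compress _ _ J K).

Definition hilbert_schmidt (R : realType) (n : nat) (K : int * 'I_n -> int * 'I_n -> R[i]) : Prop :=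
  exists M : R, forall J : nat,
    \sum_(a : 'I_(2 * J + 1) * 'I_n) \sum_(b : 'I_(2 * J + 1) * 'I_n)
       cabs (@compress _ _ J K a b) ^+ 2 <= M.

(* d = det_2(I + K): K is Hilbert-Schmidt and d is the limit of det_2 of the
   compressions of K to the increasing subspaces H_J (whose union is dense) *)
Definition is_det2_Iplus (R : realType) (n : nat) (K : int * 'I_n -> int * 'I_n -> R[i]) (d : R[i])
  : Prop :=
  hilbert_schmidt K /\
  forall eps : R, 0 < eps -> exists N : nat, forall J : nat, (N <= J)%N ->
    cabs (@det2_trunc _ _ J K - d) < eps.

(* Main.v *)
Require Import Defs.
From HB Require Import structures.
From mathcomp Require Import all_boot all_order all_algebra perm.
From mathcomp Require Import all_classical all_reals all_analysis.
From mathcomp Require Import measurable_realfun complex ring lra zify.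
Set Implicit Arguments. Unset Strict Implicit. Unset Printing Implicit Defensive.
Import Order.TTheory GRing.Theory Num.Theory.
Import numFieldNormedType.Exports.
Local Open Scope ring_scope.

(** Enlarge the truncation by one basis vector at a time.  If the matrix [A] is
    bordered by a row [v], a column [u] and a corner [d], then
    [det (I + A') = (1 + d) det (I + A) + det [[0, v], [u, I + A]]], hence
    [det2 (I + A') - det2 (I + A)] equals [exp (- tr A)] times
    [((1 + d) exp (- d) - 1) det (I + A) + exp (- d) det [[0, v], [u, I + A]]].
    Hadamard's inequality together with [1 + x <= exp x] bounds this by a constant,
    depending only on the Hilbert-Schmidt norm of [A], times [|d|^2 + |u| |v|].
    For the operator [K], with weight [w k = 1 + xi_k^2], the row and the
    truncated column of index [k] both have squared norm [O(1 / w k)]: for the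
    rows this is the decay of the multipliers, and for the columns it follows
    from Peetre's inequality [w k <= 2 w m w (k - m)] and the [H^1] bound on the
    coefficients.  The increments are therefore [O(k^-2)], so the truncated
    determinants are Cauchy, even with rate [1 / J]. *)

(** * Hadamard's inequality *)

Section Hadamard.
Local Open Scope sesquilinear_scope.

Lemma mulmx_adj_diag (C : numClosedFieldType) m n (A : 'M[C]_(m, n)) i :
  (A *m A^t*) i i = \sum_j `|A i j| ^+ 2.
Proof. by rewrite !mxE; apply: eq_bigr => j _; rewrite !mxE normCK. Qed.

Lemma norm_det_unitary (C : numClosedFieldType) m (U : 'M[C]_m) :
  U \is unitarymx -> `|\det U| = 1.
Proof.
move=> /unitarymxP/(congr1 determinant); rewrite det_mulmx det1 det_map_mx det_tr.
rewrite -normCK => /eqP; rewrite sqrf_eq1 => /orP[/eqP//|/eqP h].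
by have := normr_ge0 (\det U); rewrite h oppr_ge0 ler10.
Qed.

(** Gram-Schmidt keeps row [i] of [A] in the span of the orthonormal rows of index at most [i], so
    it is orthogonal to every later one. This gives the triangular factor of an LQ decomposition. *)
Lemma schmidt_trig (C : numClosedFieldType) m (A : 'M[C]_m) :
  is_trig_mx (A *m (schmidt A)^t*).
Proof.
have uQ : schmidt A \is unitarymx by exact: schmidt_unitarymx.
apply/is_trig_mxP => i j lt_ij.
have -> : (A *m (schmidt A)^t*) i j = (row i A *m (row j (schmidt A))^t*) 0 0.
  by rewrite !mxE; apply: eq_bigr => k _; rewrite !mxE.
suff /sub_kermxP-> : (row i A <= kermx ((row j (schmidt A))^t* ))%MS by rewrite mxE.
apply: submx_trans (row_schmidt_sub A i) _.
apply/sumsmx_subP => k le_ki; rewrite genmxE; apply/sub_kermxP/matrixP => a b.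
have := unitarymxP uQ => /matrixP/(_ k j); rewrite !mxE.
have /negPf-> : k != j by apply: contraTneq lt_ij => <-; rewrite -leqNgt.
by move=> /= h; rewrite -[RHS]h; apply: eq_bigr => l _; rewrite !mxE.
Qed.

(** Write [A = L Q] with [Q] unitary and [L] triangular. The unitary factor changes neither [|det|]
    nor the row norms, and [|L i i|] is at most the norm of row [i] of [L]. *)
Theorem hadamard (C : numClosedFieldType) m (A : 'M[C]_m) :
  `|\det A| ^+ 2 <= \prod_i \sum_j `|A i j| ^+ 2.
Proof.
have uQ : schmidt A \is unitarymx by exact: schmidt_unitarymx.
have AE : A = (A *m (schmidt A)^t*) *m schmidt A by rewrite mulmxKtV.
set L := A *m _ in AE.
have rowE i : \sum_j `|A i j| ^+ 2 = \sum_j `|L i j| ^+ 2.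
  rewrite -!mulmx_adj_diag [in LHS]AE trmx_mul map_mxM mulmxA.
  by rewrite -(mulmxA L) (unitarymxP uQ) mulmx1.
rewrite {1}AE det_mulmx normrM (norm_det_unitary uQ) mulr1.
rewrite det_trig ?schmidt_trig // normr_prod -prodrXl.
apply: ler_prod => i _; rewrite exprn_ge0 // rowE (bigD1 i) //= lerDl.
by apply: sumr_ge0 => j _; rewrite exprn_ge0.
Qed.

End Hadamard.

(** * The complex exponential *)

Section Cabs.
Variable R : realType.
Implicit Types (x y : R) (z : R[i]).

Lemma cabs_ge0 z : 0 <= cabs z.
Proof. by case: z => a b; rewrite sqrtr_ge0. Qed.

Lemma cabsE z : `|z| = (cabs z)%:C%C.
Proof. by case: z. Qed.

Lemma cabs_sqr z : cabs z ^+ 2 = complex.Re z ^+ 2 + complex.Im z ^+ 2.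
Proof. by case: z => a b; rewrite /cabs /= sqr_sqrtr// addr_ge0// sqr_ge0. Qed.

Lemma cabs0 : cabs (0 : R[i]) = 0. Proof. exact: Normc.normc0. Qed.
Lemma cabs1 : cabs (1 : R[i]) = 1. Proof. exact: Normc.normc1. Qed.
Lemma cabsM z z' : cabs (z * z') = cabs z * cabs z'.
Proof. exact: Normc.normcM. Qed.
Lemma cabsD z z' : cabs (z + z') <= cabs z + cabs z'.
Proof. exact: le_normcD. Qed.
Lemma cabsN z : cabs (- z) = cabs z.
Proof. exact: normcN. Qed.
Lemma cabsB z z' : cabs (z - z') <= cabs z + cabs z'.
Proof. by rewrite -(cabsN z') cabsD. Qed.
Lemma cabsV z : cabs z^-1 = (cabs z)^-1.
Proof. exact: Normc.normcV. Qed.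

Lemma cabs_real x : cabs x%:C%C = `|x|.
Proof. by rewrite /cabs /= expr0n addr0 sqrtr_sqr. Qed.

Lemma cabs_le z x : 0 <= x -> cabs z ^+ 2 <= x ^+ 2 -> cabs z <= x.
Proof. by move=> x0; rewrite ler_sqr ?nnegrE ?cabs_ge0. Qed.

Lemma Re_le_cabs z : `|complex.Re z| <= cabs z.
Proof.
rewrite -ler_sqr ?nnegrE ?cabs_ge0 // cabs_sqr real_normK ?num_real //.
by rewrite lerDl sqr_ge0.
Qed.

Lemma Im_le_cabs z : `|complex.Im z| <= cabs z.
Proof.
rewrite -ler_sqr ?nnegrE ?cabs_ge0 // cabs_sqr real_normK ?num_real //.
by rewrite lerDr sqr_ge0.
Qed.

Lemma cabs_le_ReIm z : cabs z <= `|complex.Re z| + `|complex.Im z|.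
Proof.
apply: cabs_le; first by rewrite addr_ge0.
rewrite cabs_sqr sqrrD !real_normK ?num_real //.
by rewrite lerD2r lerDl mulrn_wge0 ?mulr_ge0.
Qed.

Lemma cabs_cexp z : cabs (cexp z) = expR (complex.Re z).
Proof.
apply/eqP; rewrite -(eqrXn2 (ltn0Sn 1)) ?cabs_ge0 ?expR_ge0 //.
by rewrite cabs_sqr /= !exprMn -mulrDr cos2Dsin2 mulr1.
Qed.

Lemma cexpD z z' : cexp (z + z') = cexp z * cexp z'.
Proof.
case: z => a b; case: z' => c d; apply/eqP.
rewrite eq_complex /= expRD cosD sinD.
by apply/andP; split; apply/eqP; ring.
Qed.

Lemma norm_expR_sub1 x : `|expR x - 1| <= `|x| * expR `|x|.
Proof.
have e1 := expR_ge1Dx x; have e2 := expR_ge1Dx (- x).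
have ep := expR_gt0 x; have en := expR_gt0 (- x).
have ee : expR x * expR (- x) = 1 by rewrite -expRD subrr expR0.
have [x0|x0] := lerP 0 x.
  by rewrite (ger0_norm x0) ger0_norm; nra.
by rewrite (ltr0_norm x0) ler0_norm; nra.
Qed.

(** Multiplying [1 - x <= expR (- x)] by [expR x] gives [expR x - 1 - x <= x * (expR x - 1)], which
    reduces the second-order estimate to the first-order one. *)
Lemma norm_expR_sub1x x : `|expR x - 1 - x| <= x ^+ 2 * expR `|x|.
Proof.
have e1 := expR_ge1Dx x.
have h := norm_expR_sub1 x.
have ep := expR_gt0 x.
have ee : expR x * expR (- x) = 1 by rewrite -expRD subrr expR0.
have e2 := expR_ge1Dx (- x).
have -> : `|expR x - 1 - x| = expR x - 1 - x by rewrite ger0_norm; lra.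
have : expR x - 1 - x <= x * (expR x - 1) by nra.
move=> /le_trans; apply; apply: le_trans (ler_norm _) _; rewrite normrM.
rewrite -(real_normK (num_real x)) expr2 -mulrA.
by rewrite ler_wpM2l.
Qed.

Lemma norm_sin_le x : `|sin x| <= `|x|.
Proof.
wlog x0 : x / 0 <= x => [hw|].
  have [|/ltW x0] := lerP 0 x; first exact: hw.
  by rewrite -normrN -sinN -(normrN x) hw ?oppr_ge0.
have [|c _] := @MVT_segment R sin cos 0 x x0 (fun c _ => is_derive_sin c).
  by apply: continuous_subspaceT => t; exact: continuous_sin.
rewrite sin0 !subr0 => ->; rewrite normrM ler_piMl //.
by rewrite ler_norml cos_geN1 cos_le1.
Qed.

(** The quadratic bound serves the real part of [cexp z - 1 - z]; the linear one bounds the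
    derivative of [sin t - t] in the next lemma. *)
Lemma norm_cos_sub1 x : `|cos x - 1| <= x ^+ 2 /\ `|cos x - 1| <= `|x|.
Proof.
wlog x0 : x / 0 <= x => [hw|].
  have [|/ltW x0] := lerP 0 x; first exact: hw.
  by rewrite -cosN -sqrrN -(normrN x); apply: hw; rewrite oppr_ge0.
have [|c] := @MVT_segment R cos (fun t => - sin t) 0 x x0
    (fun c _ => is_derive_cos c).
  by apply: continuous_subspaceT => t; exact: continuous_cos.
rewrite cos0 subr0 in_itv /= => /andP[c0 cx] ->.
rewrite normrM normrN (ger0_norm x0); split.
  rewrite expr2 ler_wpM2r // (le_trans (norm_sin_le c)) //.
  by rewrite ger0_norm.
by rewrite ler_piMl // sin_max.
Qed.

Lemma norm_sin_subx x : `|sin x - x| <= x ^+ 2.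
Proof.
wlog x0 : x / 0 <= x => [hw|].
  have [|/ltW x0] := lerP 0 x; first exact: hw.
  by rewrite -normrN opprD -sinN -sqrrN hw ?oppr_ge0.
have [|c] := @MVT_segment R (fun t => sin t - t) (fun t => cos t - 1) 0 x x0.
- apply: continuous_subspaceT => t; apply: cvgB; first exact: continuous_sin.
  exact: cvg_id.
rewrite sin0 !subr0 in_itv /= => /andP[c0 cx] ->.
rewrite normrM expr2 (ger0_norm x0) ler_wpM2r //.
by apply: le_trans (norm_cos_sub1 c).2 _; rewrite ger0_norm.
Qed.

Lemma cabs_cexp_sub1z z :
  cabs (cexp z - 1 - z) <= 3 * cabs z ^+ 2 * expR (cabs z).
Proof.
have ha := Re_le_cabs z.
apply: le_trans (cabs_le_ReIm _) _; rewrite cabs_sqr.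
move: (cabs z) ha => r; case: z => a b /= ha; rewrite !subr0.
(* Real and imaginary parts are each cut into two pieces of second order in [(a, b)]. *)
have -> : expR a * cos b - 1 - a = (expR a - 1 - a) + expR a * (cos b - 1) by ring.
have -> : expR a * sin b - b = expR a * (sin b - b) + b * (expR a - 1) by ring.
have aE : expR `|a| <= expR r by rewrite ler_expR.
have eE : expR a <= expR r by rewrite ler_expR (le_trans (ler_norm a)).
have h1 : `|expR a - 1 - a| <= a ^+ 2 * expR r.
  by apply: le_trans (norm_expR_sub1x a) _; rewrite ler_wpM2l ?sqr_ge0.
have h2 : `|expR a * (cos b - 1)| <= expR r * b ^+ 2.
  rewrite normrM (ger0_norm (expR_ge0 a)) ler_pM ?expR_ge0 //.
  exact: (norm_cos_sub1 b).1.
have h3 : `|expR a * (sin b - b)| <= expR r * b ^+ 2.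
  by rewrite normrM (ger0_norm (expR_ge0 a)) ler_pM ?expR_ge0 // norm_sin_subx.
have h4 : `|b * (expR a - 1)| <= `|b| * (`|a| * expR r).
  rewrite normrM ler_wpM2l // (le_trans (norm_expR_sub1 a)) //.
  by rewrite ler_wpM2l.
have := ler_normD (expR a - 1 - a) (expR a * (cos b - 1)).
have := ler_normD (expR a * (sin b - b)) (b * (expR a - 1)).
have := expR_gt0 r; move: h1 h2 h3 h4.
rewrite -(real_normK (num_real a)) -(real_normK (num_real b)).
move: (expR r) `|a| `|b| => E p q h1 h2 h3 h4 E0 h5 h6.
(* The mixed term [p * q] is absorbed by this square; the constant 3 leaves room for it. *)
have : 0 <= E * (p - q) ^+ 2 by rewrite mulr_ge0 ?sqr_ge0 // ltW.
have : 0 <= E * p ^+ 2 by rewrite mulr_ge0 ?sqr_ge0 // ltW.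
have : 0 <= E * q ^+ 2 by rewrite mulr_ge0 ?sqr_ge0 // ltW.
by move: h1 h2 h3 h4 h5 h6; rewrite !expr2; lra.
Qed.

(** The first-order terms cancel, [(1 + z)(1 - z) - 1 = - z^2]: owing to the trace correction, a
    small corner costs only [|z|^2]. *)
Lemma cabs_det2_scalar_sub1 z :
  cabs ((1 + z) * cexp (- z) - 1) <= cabs z ^+ 2 * (1 + 3 * (1 + cabs z) * expR (cabs z)).
Proof.
have -> : (1 + z) * cexp (- z) - 1
    = (1 + z) * (cexp (- z) - 1 - (- z)) - z * z by ring.
apply: le_trans (cabsB _ _) _; rewrite !cabsM.
have := cabs_cexp_sub1z (- z); rewrite cabsN => h.
have h1 := cabsD 1 z; rewrite cabs1 in h1.
have : cabs (1 + z) * cabs (cexp (- z) - 1 - - z) <=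
  (1 + cabs z) * (3 * cabs z ^+ 2 * expR (cabs z)).
  by rewrite ler_pM // cabs_ge0.
move: (cabs z) => r; move: (cabs _ * cabs _) (expR r) => p E.
by rewrite expr2; lra.
Qed.
End Cabs.

(** * Bordering a matrix *)

(** [big_ord_recl] speaks of [ord0] and [lift], block matrices of [lshift] and [rshift]; this lemma
    and the next reconcile them. *)
Lemma ord0_lshift m : ord0 = lshift m ord0 :> 'I_(1 + m).
Proof. exact: val_inj. Qed.

Lemma lift0_rshift m (i : 'I_m) : lift ord0 i = rshift 1 i :> 'I_(1 + m).
Proof. exact: val_inj. Qed.

Section Det2.
Variable R : realType.
Local Notation C := R[i].

Lemma hadamard_cabs m (A : 'M[C]_m) :
  cabs (\det A) ^+ 2 <= \prod_i \sum_j cabs (A i j) ^+ 2.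
Proof.
rewrite -lecR rmorphXn /= -cabsE (le_trans (hadamard A)) // rmorph_prod /=.
rewrite le_eqVlt; apply/orP; left; apply/eqP; apply: eq_bigr => i _.
by rewrite rmorph_sum; apply: eq_bigr => j _; rewrite cabsE rmorphXn.
Qed.

Definition hsnorm2 m (A : 'M[C]_m) : R := \sum_i \sum_j cabs (A i j) ^+ 2.

(** On the diagonal [|1 + a|^2 = 1 + 2 Re a + |a|^2]; then [1 + x <= exp x] applies. The slack [e]
    makes room for the extra entry of a bordered row. *)
Lemma row_norm2_addI m (A : 'M[C]_m) i (e : R) :
  \sum_j cabs ((1%:M + A) i j) ^+ 2 + e <=
  expR (2 * complex.Re (A i i) + \sum_j cabs (A i j) ^+ 2 + e).
Proof.
apply: le_trans (expR_ge1Dx _); rewrite addrA lerD2r.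
rewrite (bigD1 i) //= [\sum_j cabs (A i j) ^+ 2](bigD1 i) //= !mxE eqxx.
rewrite (eq_bigr (fun j => cabs (A i j) ^+ 2)) => [|j /negPf ji]; last first.
  by rewrite !mxE eq_sym ji add0r.
by rewrite !addrA lerD2r !cabs_sqr; case: (A i i) => a b /=; lra.
Qed.

Lemma Re_trace m (A : 'M[C]_m) : complex.Re (\tr A) = \sum_i complex.Re (A i i).
Proof. by rewrite /mxtrace (big_morph (@complex.Re R) (id1 := 0) (op1 := +%R)) // => -[a b] []. Qed.

(** The diagonal terms collect into [exp (Re tr A)^2], exactly what the factor [|exp (- tr A)|^2] of
    the squared [det2] cancels. *)
Lemma prod_expR m (A : 'M[C]_m) (e : 'I_m -> R) :
  \prod_i expR (2 * complex.Re (A i i) + \sum_j cabs (A i j) ^+ 2 + e i) =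
  expR (hsnorm2 A + \sum_i e i) * expR (complex.Re (\tr A)) ^+ 2.
Proof.
rewrite -expRM_natl -expRD -expR_sum; congr expR.
by rewrite !big_split /= -mulr_sumr Re_trace /hsnorm2; ring.
Qed.

(** Carleman's inequality, obtained from Hadamard's by exponentiating every row norm. *)
Lemma cabs_det2_le m (A : 'M[C]_m) :
  cabs (\det (1%:M + A) * cexp (- \tr A)) <= expR (hsnorm2 A / 2).
Proof.
apply: cabs_le; first exact: expR_ge0.
rewrite cabsM exprMn cabs_cexp.
have E0 := expR_gt0 (complex.Re (\tr A)).
have -> : complex.Re (- \tr A) = - complex.Re (\tr A) by case: (\tr A).
rewrite expRN exprVn ler_pdivrMr ?exprn_gt0 //.
apply: le_trans (hadamard_cabs _) _.
have := prod_expR A (fun=> 0); rewrite big1_eq addr0 => h.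
rewrite -expRM_natl (_ : 2%:R * _ = hsnorm2 A) -?h; last by field.
apply: ler_prod => i _; apply/andP; split.
  by apply: sumr_ge0 => j _; exact: sqr_ge0.
by have := row_norm2_addI A i 0; rewrite addr0.
Qed.

Lemma det_scale_lcol m (v : 'rV[C]_m) (u : 'cV[C]_m) (N : 'M[C]_m) (t : C) :
  \det (block_mx 0 v (t *: u) N : 'M[C]_(1 + m)) = t * \det (block_mx 0 v u N : 'M[C]_(1 + m)).
Proof.
have -> : block_mx 0 v (t *: u) N =
    (block_mx 0 v u N : 'M[C]_(1 + m)) *m block_mx t%:M 0 0 1%:M.
  by rewrite mulmx_block !(mulmx0, mul0mx, addr0, add0r, mulmx1) mul_mx_scalar.
by rewrite det_mulmx det_ublock det1 mulr1 det_scalar1 mulrC.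
Qed.

(** The column is first rescaled to norm at most 1, which pulls out the factor [t]. In Hadamard's
    product the first row then gives [r], and the rescaled column adds at most 1 to the exponent. *)
Lemma cabs_det2_border_le m (A : 'M[C]_m) (v : 'rV[C]_m) (u : 'cV[C]_m) (t r : R) :
  0 < t -> 0 <= r ->
  \sum_i cabs (u i 0) ^+ 2 <= t ^+ 2 -> \sum_j cabs (v 0 j) ^+ 2 <= r ^+ 2 ->
  cabs (\det (block_mx 0 v u (1%:M + A) : 'M[C]_(1 + m)) * cexp (- \tr A))
    <= t * r * expR ((hsnorm2 A + 1) / 2).
Proof.
move=> t0 r0 hu hv.
have tC : (t%:C)%C != 0 :> C by rewrite eq_complex /= gt_eqF.
have -> : u = (t%:C)%C *: ((t^-1)%:C%C *: u).
  by rewrite scalerA -rmorphM /= divff ?gt_eqF // scale1r.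
rewrite det_scale_lcol -!mulrA cabsM cabs_real gtr0_norm //.
rewrite ler_wpM2l ?(ltW t0) //.
apply: cabs_le; first by rewrite mulr_ge0 ?expR_ge0.
rewrite cabsM !exprMn cabs_cexp.
have E0 := expR_gt0 (complex.Re (\tr A)).
have -> : complex.Re (- \tr A) = - complex.Re (\tr A) by case: (\tr A).
rewrite expRN exprVn ler_pdivrMr ?exprn_gt0 //.
apply: le_trans (hadamard_cabs _) _.
rewrite big_ord_recl /= -expRM_natl.
have -> : 2%:R * ((hsnorm2 A + 1) / 2) = hsnorm2 A + 1 by field.
rewrite -mulrA; apply: ler_pM.
- by apply: sumr_ge0 => j _; exact: sqr_ge0.
- by apply: prodr_ge0 => i _; apply: sumr_ge0 => j _; exact: sqr_ge0.
- rewrite big_ord_recl ord0_lshift block_mxEul mxE cabs0 expr0n /= add0r.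
  rewrite (eq_bigr (fun j => cabs (v 0 j) ^+ 2)) // => j _.
  by rewrite -ord0_lshift lift0_rshift ord0_lshift block_mxEur.
(* Squared modulus of the rescaled column entry in row [i]; these sum to at most 1 by [hu]. *)
pose e i := t^-1 ^+ 2 * cabs (u i 0) ^+ 2.
apply: (@le_trans _ _ (\prod_i expR
    (2 * complex.Re (A i i) + \sum_j cabs (A i j) ^+ 2 + e i))).
  apply: ler_prod => i _; apply/andP; split.
    by apply: sumr_ge0 => j _; exact: sqr_ge0.
  apply: le_trans (row_norm2_addI A i (e i)).
  rewrite big_ord_recl addrC lift0_rshift ord0_lshift.
  rewrite block_mxEdl mxE cabsM exprMn cabs_real real_normK ?num_real //.
  rewrite lerD2r le_eqVlt; apply/orP; left; apply/eqP/eq_bigr => j _.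
  by rewrite -ord0_lshift lift0_rshift block_mxEdr.
rewrite prod_expR ler_wpM2r ?exprn_ge0 ?expR_ge0 // ler_expR lerD2l.
by rewrite -mulr_sumr exprVn ler_pdivrMl ?exprn_gt0 // mulr1.
Qed.

(** Linearity in the first row, [(d, v) = (d, 0) + (0, v)]; the first summand gives a block
    triangular matrix. *)
Lemma det_border_split m (v : 'rV[C]_m) (u : 'cV[C]_m) (N : 'M[C]_m) (d : C) :
  \det (block_mx d%:M v u N : 'M[C]_(1 + m)) =
  d * \det N + \det (block_mx 0 v u N : 'M[C]_(1 + m)).
Proof.
have -> : d * \det N = \det (block_mx d%:M 0 u N : 'M[C]_(1 + m)).
  by rewrite det_lblock det_scalar1.
rewrite (@determinant_multilinear _ _ _ (block_mx d%:M 0 u N : 'M[C]_(1 + m))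
   (block_mx 0 v u N : 'M[C]_(1 + m)) ord0 1 1); first by rewrite !mul1r.
- by rewrite ord0_lshift /block_mx !rowKu !row_id !scale1r add_row_mx ?raddf0 /= addr0 add0r.
- by apply/matrixP => i j; rewrite [LHS]mxE [RHS]mxE lift0_rshift /block_mx !col_mxEd.
- by apply/matrixP => i j; rewrite [LHS]mxE [RHS]mxE lift0_rshift /block_mx !col_mxEd.
Qed.

(** A single [t] controls corner, column and row, so the increment is quadratic in [t]; [T] and [H]
    make the remaining factor the same at every step. *)
Lemma cabs_det2_incr m (A : 'M[C]_m) (v : 'rV[C]_m) (u : 'cV[C]_m) (d : C) (t T H : R) :
  0 < t <= T -> cabs d <= t -> hsnorm2 A <= H ->
  \sum_i cabs (u i 0) ^+ 2 <= t ^+ 2 -> \sum_j cabs (v 0 j) ^+ 2 <= t ^+ 2 ->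
  cabs (\det (1%:M + (block_mx d%:M v u A : 'M[C]_(1 + m))) * cexp (- (d + \tr A))
        - \det (1%:M + A) * cexp (- \tr A))
  <= t ^+ 2 * (expR (H / 2) * (1 + 3 * (1 + T) * expR T)
               + expR T * expR ((H + 1) / 2)).
Proof.
move=> /andP[t0 tT] hd hA hu hv.
rewrite scalar_mx_block add_block_mx !add0r -raddfD /= det_border_split opprD cexpD.
set B := \det (block_mx _ _ _ _).
(* Exact splitting: the old [det2] times the scalar correction of the corner, plus the zero-corner
   determinant [B]. *)
have -> : ((1 + d) * \det (1%:M + A) + B) * (cexp (- d) * cexp (- \tr A)) -
    \det (1%:M + A) * cexp (- \tr A) =
    (\det (1%:M + A) * cexp (- \tr A)) * ((1 + d) * cexp (- d) - 1)
    + cexp (- d) * (B * cexp (- \tr A)) by ring.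
apply: le_trans (cabsD _ _) _; rewrite [leRHS]mulrDr cabsM (cabsM _ ((1 + d) * _ - 1)).
have h1 := cabs_det2_le A.
have h2 := cabs_det2_border_le A t0 (ltW t0) hu hv; rewrite -/B in h2.
have h3 := cabs_det2_scalar_sub1 d.
have dT : cabs d <= T := le_trans hd tT.
have d0 := cabs_ge0 d.
have eT : expR (cabs d) <= expR T by rewrite ler_expR.
apply: lerD.
  rewrite mulrCA; apply: ler_pM; rewrite ?cabs_ge0 //.
    by apply: le_trans h1 _; rewrite ler_expR ler_pM2r.
  apply: le_trans h3 _; apply: ler_pM.
  - exact: sqr_ge0.
  - by rewrite addr_ge0 // !mulr_ge0 ?expR_ge0 // addr_ge0.
  - by rewrite ler_sqr ?nnegrE ?(ltW t0).
  - rewrite lerD2l; apply: ler_pM; rewrite ?expR_ge0 ?mulr_ge0 ?addr_ge0 //.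
    by rewrite ler_pM2l // lerD2l.
rewrite mulrCA; apply: ler_pM; rewrite ?cabs_ge0 //.
  rewrite cabs_cexp (le_trans _ eT) // ler_expR.
  by rewrite (le_trans (ler_norm _)) // -(cabsN d) Re_le_cabs.
apply: le_trans h2 _; rewrite -expr2 ler_wpM2l ?sqr_ge0 // ler_expR ler_pM2r //.
by rewrite lerD2r.
Qed.
End Det2.

(** * Determinants indexed by lists of Fourier modes *)

Section SeqDet.
Variables (R : realType) (S : eqType) (K : S -> S -> R[i]).

Definition kmx m (t : m.-tuple S) : 'M[R[i]]_m := \matrix_(i, j) K (tnth t i) (tnth t j).
Definition det2t m (t : m.-tuple S) : R[i] :=
  \det (1%:M + kmx t) * cexp (- \tr (kmx t)).
(** With lists as index sets, bordering a matrix is [cons], and successive truncations can be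
    reordered and concatenated freely. *)
Definition det2s (s : seq S) : R[i] := det2t (in_tuple s).

Lemma det2t_val m (t : m.-tuple S) : det2t t = det2s t.
Proof.
(* The length [m] equals [size s] only propositionally, so the equality is eliminated before
   comparing matrices. *)
case: t => s sz; move: (sz); rewrite /det2s /=; case: _ / (eqP sz) => sz'.
by congr det2t; apply: val_inj.
Qed.

(** Reordering conjugates by a permutation matrix: the two signs multiply to 1 and the trace is
    merely reindexed. *)
Lemma det2t_perm m (t : m.-tuple S) (p : {perm 'I_m}) :
  det2t [tuple tnth t (p i) | i < m] = det2t t.
Proof.
have e : kmx [tuple tnth t (p i) | i < m] = row_perm p (col_perm p (kmx t)).
  by apply/matrixP => i j; rewrite !mxE !tnth_mktuple.
have e1 : 1%:M = row_perm p (col_perm p (1%:M : 'M[R[i]]_m)).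
  by apply/matrixP => i j; rewrite !mxE (inj_eq perm_inj).
rewrite /det2t e {1}e1 -!linearD /=; congr (_ * cexp (- _)).
  rewrite row_permE col_permE !det_mulmx !det_perm mulrCA mulrA -mulrA.
  by rewrite odd_permV -signr_addb addbb mulr1.
rewrite /mxtrace [RHS](reindex_inj (@perm_inj _ p)).
by apply: eq_bigr => i _; rewrite !mxE.
Qed.

Lemma det2s_perm (s s' : seq S) : perm_eq s s' -> det2s s = det2s s'.
Proof.
move=> ss'; have /tuple_permP[p sE] : perm_eq s (in_tuple s') by [].
by rewrite sE -det2t_val det2t_perm.
Qed.

Lemma kmx_cons x s :
  kmx (in_tuple (x :: s)) =
  block_mx (K x x)%:M (\row_j K x (tnth (in_tuple s) j))
    (\col_i K (tnth (in_tuple s) i) x) (kmx (in_tuple s)) :> 'M[R[i]]_(1 + size s).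
Proof.
apply/matrixP => i j; rewrite [LHS]mxE.
have t0 : tnth (in_tuple (x :: s)) ord0 = x by [].
have tS k : tnth (in_tuple (x :: s)) (lift ord0 k) = tnth (in_tuple s) k.
  by rewrite !(tnth_nth x).
case: (unliftP ord0 i) => [i'|] ->; case: (unliftP ord0 j) => [j'|] ->;
  rewrite ?t0 ?tS.
- by rewrite !lift0_rshift block_mxEdr mxE.
- by rewrite lift0_rshift [in RHS]ord0_lshift block_mxEdl mxE.
- by rewrite lift0_rshift [in RHS]ord0_lshift block_mxEur mxE.
- by rewrite [in RHS]ord0_lshift block_mxEul mxE mulr1n.
Qed.

Lemma hsnorm2_kmx s :
  hsnorm2 (kmx (in_tuple s)) = \sum_(x <- s) \sum_(y <- s) cabs (K x y) ^+ 2.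
Proof.
rewrite /hsnorm2 [RHS]big_tnth; apply: eq_bigr => i _.
by rewrite [RHS]big_tnth; apply: eq_bigr => j _; rewrite mxE.
Qed.

Lemma det2s_incr x s (t T H : R) :
  0 < t <= T -> cabs (K x x) <= t ->
  \sum_(x <- s) \sum_(y <- s) cabs (K x y) ^+ 2 <= H ->
  \sum_(y <- s) cabs (K y x) ^+ 2 <= t ^+ 2 ->
  \sum_(y <- s) cabs (K x y) ^+ 2 <= t ^+ 2 ->
  cabs (det2s (x :: s) - det2s s) <=
  t ^+ 2 * (expR (H / 2) * (1 + 3 * (1 + T) * expR T) + expR T * expR ((H + 1) / 2)).
Proof.
move=> ht hd hH hu hv; rewrite /det2s /det2t.
have -> : \tr (kmx (in_tuple (x :: s))) = K x x + \tr (kmx (in_tuple s)).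
  rewrite /mxtrace big_ord_recl; congr (_ + _); first by rewrite mxE.
  by apply: eq_bigr => i _; rewrite !mxE !(tnth_nth x).
rewrite kmx_cons; apply: (cabs_det2_incr ht hd); first by rewrite hsnorm2_kmx.
- by apply: le_trans hu; rewrite [leRHS]big_tnth; apply: ler_sum => i _; rewrite mxE.
- by apply: le_trans hv; rewrite [leRHS]big_tnth; apply: ler_sum => i _; rewrite mxE.
Qed.
End SeqDet.

(** * Index sets of the truncations and the shells between them *)

Section Box.
Variables (n : nat).
Local Notation I := (int * 'I_n)%type.

Definition box (J : nat) : seq I :=
  [seq (idxJ a.1, a.2) | a : 'I_(2 * J + 1) * 'I_n].

Lemma idxJ_inj J : injective (@idxJ J).
Proof. by move=> p q; rewrite /idxJ => /addIr[/val_inj]. Qed.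

Lemma boxP J (x : I) : (x \in box J) = (absz x.1 <= J)%N.
Proof.
apply/idP/idP.
  by move=> /mapP[[p i] _ ->] /=; rewrite /idxJ; have := ltn_ord p; lia.
case: x => k i /= kJ.
have pJ : (absz (k + J%:Z)%R < 2 * J + 1)%N by lia.
apply/mapP; exists (Ordinal pJ, i); first by rewrite mem_enum.
by rewrite /idxJ /=; congr pair; lia.
Qed.

Lemma box_uniq J : uniq (box J).
Proof.
rewrite map_inj_uniq ?enum_uniq // => -[p i] [q j] /= [/idxJ_inj -> ->] //.
Qed.

Lemma size_box J : size (box J) = ((2 * J + 1) * n)%N.
Proof. by rewrite size_map -cardE card_prod !card_ord. Qed.

Definition shell (J : nat) : seq I := [seq x <- box J.+1 | x \notin box J].

Lemma perm_box J : perm_eq (box J.+1) (shell J ++ box J).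
Proof.
apply: uniq_perm; first exact: box_uniq.
  rewrite cat_uniq filter_uniq ?box_uniq // andbT /=.
  by apply/hasPn => x xb; rewrite mem_filter xb.
move=> x; rewrite mem_cat mem_filter; case: (boolP (x \in box J)) => //=; rewrite ?orbT ?orbF //.
by rewrite !boxP => /leqW ->.
Qed.

Lemma shellP J x : x \in shell J -> absz x.1 = J.+1.
Proof.
rewrite mem_filter !boxP -ltnNge => /andP[h1 h2].
by apply/eqP; rewrite eqn_leq h1 h2.
Qed.

Lemma size_shell J : size (shell J) = (2 * n)%N.
Proof.
have /perm_size := perm_box J; rewrite size_cat !size_box.
by rewrite (_ : 2 * J.+1 + 1 = 2 + (2 * J + 1))%N 1?mulnDl; [move/addIn|lia].
Qed.

Variable R : realType.

Lemma sum_box (F : I -> R) J :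
  \sum_(y <- box J) F y = \sum_(a : 'I_(2 * J + 1) * 'I_n) F (idxJ a.1, a.2).
Proof. by rewrite big_map big_enum. Qed.

Lemma sum_box_fst (f : int -> R) J :
  \sum_(y <- box J) f y.1 = n%:R * \sum_(p < 2 * J + 1) f (idxJ p).
Proof.
rewrite sum_box -(pair_bigA _ (fun p (i : 'I_n) => f (idxJ p))) /= mulr_sumr.
by apply: eq_bigr => p _; rewrite sumr_const card_ord mulr_natl.
Qed.

(** A duplicate-free list sits inside a large enough box. This carries bounds over boxes to the
    intermediate lists met while a shell is inserted mode by mode. *)
Lemma sum_uniq_le (F : I -> R) M (s : seq I) :
  (forall y, 0 <= F y) -> (forall J, \sum_(y <- box J) F y <= M) -> uniq s ->
  \sum_(y <- s) F y <= M.
Proof.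
move=> F0 FM us; pose J := (\max_(y <- s) absz y.1)%N.
apply: le_trans (FM J).
rewrite [leRHS](perm_big (s ++ [seq x <- box J | x \notin s])) /=; last first.
  apply: uniq_perm; first exact: box_uniq.
    rewrite cat_uniq us filter_uniq ?box_uniq // andbT /=.
    by apply/hasPn => x; rewrite mem_filter => /andP[].
  move=> y; rewrite mem_cat mem_filter; case: (boolP (y \in s)) => //= ys.
  by rewrite boxP /J (leq_bigmax_seq y).
by rewrite big_cat lerDl sumr_ge0.
Qed.
End Box.

(** * Convergence of the truncated determinants *)

(** Every lower end [u J - r J] lies below every upper end [u J' + r J'], so the supremum of the
    lower ends satisfies all the bounds at once. *)
Lemma real_limit_of_rate (R : realType) (u r : nat -> R) :
  (forall J J', (J <= J')%N -> `|u J' - u J| <= r J) ->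
  exists l, forall J, `|u J - l| <= r J.
Proof.
move=> hu.
pose E := [set x : R | exists J, x = u J - r J]%classic.
have ub J : ubound E (u J + r J).
  move=> _ [J' ->].
  have [JJ'|/ltnW J'J] := leqP J J'.
    (* Comparing an index with itself shows that [r] is nonnegative there. *)
    have := hu _ _ JJ'; have := hu J' J' (leqnn _).
    rewrite subrr normr0 => h1; rewrite ler_norml; lra.
  have := hu _ _ J'J; have := hu J J (leqnn _).
  rewrite subrr normr0 => h1; rewrite ler_norml; lra.
have hs : has_sup E by split; [exists (u 0%N - r 0%N), 0%N|exists (u 0%N + r 0%N)].
exists (sup E) => J; rewrite ler_distlC; apply/andP; split.
  by have : u J - r J <= sup E by [apply: ub_le_sup; [case: hs|exists J]]; lra.
exact: (ge_sup hs.1 (ub J)).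
Qed.

Lemma complex_limit_of_rate (R : realType) (u : nat -> R[i]) (r : nat -> R) :
  (forall J J', (J <= J')%N -> cabs (u J' - u J) <= r J) ->
  exists D, forall J, cabs (u J - D) <= 2 * r J.
Proof.
move=> hu.
have [|a ha] := @real_limit_of_rate R (fun J => complex.Re (u J)) r.
  move=> J J' JJ'; apply: le_trans (hu _ _ JJ'); apply: le_trans (Re_le_cabs _).
  by rewrite raddfB.
have [|b hb] := @real_limit_of_rate R (fun J => complex.Im (u J)) r.
  move=> J J' JJ'; apply: le_trans (hu _ _ JJ'); apply: le_trans (Im_le_cabs _).
  by rewrite raddfB.
exists (Complex a b) => J; apply: le_trans (cabs_le_ReIm _) _.
rewrite !raddfB /=; have := ha J; have := hb J; lra.
Qed.

(** With [a = J + 1], this is [a + 1 <= 2 a]; it makes sums of inverse squares telescope. *)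
Lemma inv_sqr_telescope (R : realType) (J : nat) :
  (J.+1%:R ^+ 2)^-1 <= 2 * (J.+1%:R^-1 - J.+2%:R^-1) :> R.
Proof.
have j0 : (0 : R) < J.+1%:R by [].
have -> : J.+2%:R = J.+1%:R + 1 :> R by rewrite -natr1.
have j1 : (1 : R) <= J.+1%:R by rewrite ler1n.
move: (J.+1%:R : R) j0 j1 => a a0 a1.
have -> : 2 * (a^-1 - (a + 1)^-1) = 2 / (a * (a + 1)).
  by field; rewrite !gt_eqF //; lra.
have a2 : 0 < a * (a + 1) by rewrite mulr_gt0 //; lra.
rewrite -[leLHS]mul1r ler_pdivrMr ?exprn_gt0 // mulrAC ler_pdivlMr // expr2.
by nra.
Qed.

Lemma det2_truncE (R : realType) n J (K : int * 'I_n -> int * 'I_n -> R[i]) :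
  @det2_trunc _ _ J K = det2s K (box n J).
Proof.
pose f (a : 'I_(2 * J + 1) * 'I_n) := (idxJ a.1, a.2).
have fi : injective f by move=> [p i] [q j] [/idxJ_inj -> ->].
(* Modes in the order used by [detF], so that the matrices agree entrywise; comparison with [box] is
   only up to permutation. *)
pose t := [tuple f (enum_val p) | p < #|{: 'I_(2 * J + 1) * 'I_n}|].
have /det2s_perm <- : perm_eq t (box n J).
  apply: uniq_perm; last 1 first.
  - move=> x; apply/mapP/mapP => [[p _ ->]|[a _ ->]].
      by exists (enum_val p); rewrite ?mem_enum.
    by exists (enum_rank a); rewrite ?mem_enum // enum_rankK.
  - rewrite map_inj_uniq ?enum_uniq // => p q /fi.
    exact: enum_val_inj.
  - exact: box_uniq.
rewrite -det2t_val /det2t /det2_trunc /det2_IplusF /detF /trF.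
congr (_ * cexp (- _)).
  congr (\det _); apply/matrixP => p q.
  by rewrite !mxE !tnth_mktuple (inj_eq enum_val_inj).
rewrite /mxtrace [LHS](reindex (fun p : 'I_#|{: 'I_(2 * J + 1) * 'I_n}| => enum_val p)) /=;
  last exact/onW_bij/enum_val_bij.
by apply: eq_bigr => p _; rewrite mxE !tnth_mktuple.
Qed.

(** * Convergence rate for operators dominated by a weighted convolution *)

Section Core.
Variables (R : realType) (n : nat) (M g : R).
Hypotheses (M0 : 0 <= M) (g0 : 0 < g).
Local Notation I := (int * 'I_n)%type.

(** [B] bounds sums of [w c] over modes ([n] components each, plus 1 for positivity), [W] sums of
    [1 / w], [H] the squared Hilbert-Schmidt norm, [T] every border norm; adding mode [x] changes
    [det2] by at most [Q / w x.1]. *)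
Let B : R := n%:R * M + 1.
Let W : R := n%:R + 4 * n%:R / g.
Let H : R := B * W.
Let T : R := Num.sqrt (2 * B).
Let Q : R := 2 * B * (expR (H / 2) * (1 + 3 * (1 + T) * expR T) + expR T * expR ((H + 1) / 2)).

Let B0 : 0 < B.
Proof. by rewrite ltr_wpDl // mulr_ge0. Qed.

Let Q0 : 0 <= Q.
Proof.
rewrite mulr_ge0 ?(ltW (mulr_gt0 _ B0)) // addr_ge0 ?mulr_ge0 ?expR_ge0 //.
by rewrite addr_ge0 // !mulr_ge0 ?expR_ge0 ?addr_ge0 ?sqrtr_ge0.
Qed.

Section Op.
Variables (w c : int -> R) (K : I -> I -> R[i]).
Hypotheses (w1 : forall k, 1 <= w k) (wN : forall k, w (- k) = w k)
  (wP : forall k m, w k <= 2 * w m * w (k - m))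
  (wg : forall k, g * k%:~R ^+ 2 <= w k)
  (c0 : forall k, 0 <= c k)
  (wcM : forall J, \sum_(p < 2 * J + 1) w (idxJ p) * c (idxJ p) <= M)
  (hK : forall x y, cabs (K x y) ^+ 2 <= c (x.1 - y.1) / w x.1).

Let w0 k : 0 < w k.
Proof. exact: lt_le_trans (w1 k). Qed.

Lemma sum_wc (s : seq I) : uniq s -> \sum_(y <- s) w y.1 * c y.1 <= B.
Proof.
move=> us; apply: (sum_uniq_le (F := fun y => w y.1 * c y.1)) us.
  by move=> y; rewrite mulr_ge0 // ltW.
move=> J; rewrite (sum_box_fst n (fun k => w k * c k)).
by rewrite ler_wpDr // ler_wpM2l.
Qed.

Lemma sum_wc_shift (s : seq I) (h : int -> int) : injective h -> uniq s ->
  \sum_(y <- s) w (h y.1) * c (h y.1) <= B.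
Proof.
move=> hi us.
have -> : \sum_(y <- s) w (h y.1) * c (h y.1)
    = \sum_(y <- [seq (h y.1, y.2) | y <- s]) w y.1 * c y.1 by rewrite big_map.
by apply: sum_wc; rewrite map_inj_uniq // => -[a i] [b j] [/hi -> ->].
Qed.

(** The decay sits in the factor [1 / w x.1] of [hK]; [w >= 1] lets the sum of [c] be replaced by
    that of [w c]. *)
Lemma row_bound x (s : seq I) : uniq s ->
  \sum_(y <- s) cabs (K x y) ^+ 2 <= B / w x.1.
Proof.
move=> us; rewrite ler_pdivlMr // mulr_suml.
have hi : injective (fun k : int => x.1 - k) by move=> a b /addrI/oppr_inj.
apply: le_trans (sum_wc_shift hi us); apply: ler_sum => y _ /=.
rewrite -ler_pdivlMr // (le_trans (hK x y)) // ler_pM2r ?invr_gt0 //.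
by rewrite ler_peMl.
Qed.

(** Here [hK] decays in the summed index [y]; Peetre's inequality trades [1 / w y.1] for
    [2 w (y.1 - x.1) / w x.1], and the shifted weight is absorbed by the weighted bound on [c]. *)
Lemma col_bound x (s : seq I) : uniq s ->
  \sum_(y <- s) cabs (K y x) ^+ 2 <= 2 * B / w x.1.
Proof.
move=> us; rewrite ler_pdivlMr // mulr_suml.
have hi : injective (fun k : int => k - x.1) by move=> a b /addIr.
apply: (@le_trans _ _ (2 * \sum_(y <- s) w (y.1 - x.1) * c (y.1 - x.1))); last first.
  by rewrite ler_pM2l //; exact: (sum_wc_shift hi us).
rewrite mulr_sumr; apply: ler_sum => y _ /=.
rewrite -ler_pdivlMr // (le_trans (hK y x)) // ler_pdivlMr // mulrAC ler_pdivrMr //.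
have -> : 2 * (w (y.1 - x.1) * c (y.1 - x.1)) * w y.1
  = c (y.1 - x.1) * (2 * w y.1 * w (y.1 - x.1)) by ring.
by rewrite ler_wpM2l // -(wN (y.1 - x.1)) opprB.
Qed.

Lemma winv_shell J x : x \in shell n J -> (w x.1)^-1 <= g^-1 * (J.+1%:R ^+ 2)^-1.
Proof.
move=> /shellP hx; rewrite -invfM lef_pV2 ?posrE ?mulr_gt0 ?exprn_gt0 //.
apply: le_trans (wg _); rewrite ler_pM2l // -hx.
by rewrite -(real_normK (num_real x.1%:~R)) -intr_norm natr_absz.
Qed.

Lemma sum_winv (s : seq I) : uniq s -> \sum_(y <- s) (w y.1)^-1 <= W.
Proof.
move=> us; apply: (sum_uniq_le (F := fun y : I => (w y.1)^-1)) us.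
  by move=> y; rewrite invr_ge0 ltW.
move=> J.
have ng : 0 <= 4 * n%:R / g by rewrite divr_ge0 ?mulr_ge0 // ltW.
have ww k : (w k)^-1 <= 1 by rewrite invf_le1.
(* The induction runs on this sharper bound: [n] is the contribution of [k = 0], and the bracket
   telescopes over the shells. *)
apply: (@le_trans _ _ (n%:R + 4 * n%:R / g * (1 - J.+1%:R^-1))); last first.
  by rewrite lerD2l ler_piMr // lerBlDr lerDl invr_ge0.
elim: J => [|J IH].
  rewrite invr1 subrr mulr0 addr0 (sum_box_fst n (fun k => (w k)^-1)).
  by rewrite big_ord_recl big_ord0 addr0 ler_piMr.
rewrite (perm_big _ (perm_box n J)) big_cat /=.
have hsh : \sum_(x <- shell n J) (w x.1)^-1 <= 2 * n%:R * (g^-1 * (J.+1%:R ^+ 2)^-1).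
  rewrite big_seq; apply: (@le_trans _ _ (\sum_(x <- shell n J | x \in shell n J)
      (g^-1 * (J.+1%:R ^+ 2)^-1))).
    by apply: ler_sum => x xs; exact: winv_shell.
  rewrite -big_seq big_const_seq count_predT size_shell iter_addr_0 -[leLHS]mulr_natl.
  by rewrite natrM.
apply: le_trans (lerD hsh IH) _.
have ng' : 0 <= n%:R / g by rewrite divr_ge0 // ltW.
have := ler_wpM2l ng' (inv_sqr_telescope R J).
move: ((J.+1%:R ^+ 2)^-1) (J.+1%:R^-1) (J.+2%:R^-1) (g^-1) (n%:R : R) => a b d h m.
by lra.
Qed.

Lemma hs_bound (s : seq I) : uniq s ->
  \sum_(x <- s) \sum_(y <- s) cabs (K x y) ^+ 2 <= H.
Proof.
move=> us; apply: (@le_trans _ _ (\sum_(x <- s) B / w x.1)).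
  by apply: ler_sum => x _; exact: row_bound.
by rewrite -mulr_sumr ler_pM2l // sum_winv.
Qed.

(** Bordering with [t = sqrt (2 B / w x.1)], the column bound, which also dominates the row
    bound. *)
Lemma det2s_step x (s : seq I) : uniq (x :: s) ->
  cabs (det2s K (x :: s) - det2s K s) <= Q / w x.1.
Proof.
move=> uxs; have us : uniq s by case/andP: uxs.
have t2 : 0 < 2 * B / w x.1 by rewrite divr_gt0 ?mulr_gt0.
have tE : Num.sqrt (2 * B / w x.1) ^+ 2 = 2 * B / w x.1 by rewrite sqr_sqrtr // ltW.
have BB : B / w x.1 <= 2 * B / w x.1.
  by rewrite ler_pM2r ?invr_gt0 // ler_peMl ?ler1n // ltW.
have -> : Q / w x.1 = Num.sqrt (2 * B / w x.1) ^+ 2 *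
   (expR (H / 2) * (1 + 3 * (1 + T) * expR T) + expR T * expR ((H + 1) / 2)).
  by rewrite tE /Q mulrAC.
apply: det2s_incr.
- rewrite sqrtr_gt0 t2 /= ler_wsqrtr // ler_pdivrMr // ler_peMr //.
  by rewrite mulr_ge0 // ltW.
- apply: cabs_le; first exact: sqrtr_ge0.
  (* The diagonal entry is one term of the row sum over [x :: s]. *)
  rewrite tE (le_trans _ BB) // (le_trans _ (row_bound x uxs)) // big_cons.
  by rewrite lerDl sumr_ge0 // => y _; exact: sqr_ge0.
- exact: hs_bound.
- by rewrite tE col_bound.
- by rewrite tE (le_trans _ BB) // row_bound.
Qed.

Lemma det2s_cat (l s : seq I) q : uniq (l ++ s) -> (forall x, x \in l -> (w x.1)^-1 <= q) ->
  cabs (det2s K (l ++ s) - det2s K s) <= (size l)%:R * (Q * q).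
Proof.
elim: l => [|x l IH] /= ; first by rewrite subrr cabs0 mul0r.
move=> uxl hq.
rewrite -(subrKA (det2s K (l ++ s))) (le_trans (cabsD _ _)) // -natr1 mulrDl mul1r addrC.
apply: lerD.
  apply: IH; first by case/andP: uxl.
  by move=> y yl; apply: hq; rewrite inE yl orbT.
by apply: le_trans (det2s_step uxl) _; rewrite ler_wpM2l // hq // mem_head.
Qed.

(** A shell holds [2 n] modes, each costing at most [Q / (g (J + 1)^2)]; the telescoping inequality
    contributes another factor 2. *)
Lemma det2_trunc_incr J :
  cabs (@det2_trunc _ _ J.+1 K - @det2_trunc _ _ J K) <=
  4 * n%:R * Q / g * (J.+1%:R^-1 - J.+2%:R^-1).
Proof.
rewrite !det2_truncE (det2s_perm _ (perm_box n J)).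
apply: (le_trans (@det2s_cat (shell n J) (box n J) (g^-1 * (J.+1%:R ^+ 2)^-1) _ _)).
- by rewrite -(perm_uniq (perm_box n J)) box_uniq.
- exact: winv_shell.
rewrite size_shell natrM.
have ng' : 0 <= n%:R * Q / g by rewrite divr_ge0 ?(ltW g0) // mulr_ge0.
have := ler_wpM2l ng' (inv_sqr_telescope R J).
move: ((J.+1%:R ^+ 2)^-1) (J.+1%:R^-1) (J.+2%:R^-1) (g^-1) (n%:R : R) => a b d h m.
by lra.
Qed.

Lemma det2_trunc_cauchy J J' : (J <= J')%N ->
  cabs (@det2_trunc _ _ J' K - @det2_trunc _ _ J K) <= 4 * n%:R * Q / g / J.+1%:R.
Proof.
have q0 : 0 <= 4 * n%:R * Q / g by rewrite divr_ge0 ?(ltW g0) // mulr_ge0 // mulr_ge0.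
(* The subtracted term is kept for the induction on [J'] to telescope. *)
move=> JJ'; apply: (@le_trans _ _ (4 * n%:R * Q / g * (J.+1%:R^-1 - J'.+1%:R^-1))); last first.
  by rewrite ler_wpM2l // lerBlDr lerDl invr_ge0.
elim: J' JJ' => [|J' IH]; first by rewrite leqn0 => /eqP ->; rewrite !subrr cabs0 mulr0.
rewrite leq_eqVlt => /predU1P[->|]; first by rewrite !subrr cabs0 mulr0.
rewrite ltnS => /IH h.
rewrite -(subrKA (@det2_trunc _ _ J' K)) (le_trans (cabsD _ _)) //.
apply: le_trans (lerD (det2_trunc_incr J') h) _.
by rewrite -mulrDr addrC subrKA.
Qed.

Lemma det2_trunc_limit : exists D, is_det2_Iplus K D /\
  forall J, cabs (@det2_trunc _ _ J K - D) <= 8 * n%:R * Q / g / J.+1%:R.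
Proof.
have q0 : 0 <= 8 * n%:R * Q / g by rewrite divr_ge0 ?(ltW g0) // mulr_ge0 // mulr_ge0.
have [D hD] := complex_limit_of_rate det2_trunc_cauchy.
have {}hD J : cabs (@det2_trunc _ _ J K - D) <= 8 * n%:R * Q / g / J.+1%:R.
  by apply: le_trans (hD J) _; rewrite !mulrA -natrM.
exists D; split => //; split.
  exists H => J; have := hs_bound (box_uniq n J); rewrite sum_box.
  by under eq_bigr do rewrite sum_box.
(* Beyond this index [J + 1] exceeds the rate constant divided by [e]. *)
move=> e e0; exists (Num.trunc (e^-1 * (8 * n%:R * Q / g))) => J NJ.
apply: le_lt_trans (hD J) _.
rewrite ltr_pdivrMr // -ltr_pdivrMl //.
apply: lt_le_trans (truncnS_gt _) _.
by rewrite ler_nat ltnS.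
Qed.

End Op.

(** The constant is chosen before [w], [c] and [K], from [n], [M] and [g] alone; this order of
    quantifiers yields uniformity in the spectral parameters. *)
Theorem det2_trunc_rate : exists C, 0 < C /\
  forall (w c : int -> R) (K : I -> I -> R[i]),
  (forall k, 1 <= w k) -> (forall k, w (- k) = w k) ->
  (forall k m, w k <= 2 * w m * w (k - m)) ->
  (forall k, g * k%:~R ^+ 2 <= w k) -> (forall k, 0 <= c k) ->
  (forall J, \sum_(p < 2 * J + 1) w (idxJ p) * c (idxJ p) <= M) ->
  (forall x y, cabs (K x y) ^+ 2 <= c (x.1 - y.1) / w x.1) ->
  exists D, is_det2_Iplus K D /\
    forall J, cabs (@det2_trunc _ _ J K - D) <= C / J.+1%:R.
Proof.
have q0 : 0 <= 8 * n%:R * Q / g by rewrite divr_ge0 ?(ltW g0) // mulr_ge0 // mulr_ge0.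
(* The summand 1 forces strict positivity. *)
exists (8 * n%:R * Q / g + 1); split; first by rewrite ltr_wpDl.
move=> w c K w1 wN wP wg c0 wcM hK.
have [D [hD rD]] := det2_trunc_limit w1 wN wP wg c0 wcM hK.
exists D; split=> // J; apply: le_trans (rD J) _.
by rewrite ler_pM2r ?invr_gt0 // lerDl.
Qed.
End Core.

(** * Fourier coefficients *)

Lemma is_derive_scale (R : realType) (a b x d : R) (h : R -> R) :
  is_derive (a * x) 1 h d -> is_derive x 1 (fun y => b * h (a * y)) (b * (a * d)).
Proof.
move=> dh.
have da : is_derive x 1 (fun y => a * y) a.
  have := @is_deriveZ R R R id a x 1 1 (is_derive_id x 1).
  by rewrite /GRing.scale /= mulr1.
have := @is_deriveZ R R R _ b x 1 _ (@is_derive1_comp R h (fun y => a * y) x _ _ dh da).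
by rewrite /GRing.scale /= (mulrC d).
Qed.

Section Fourier.
Local Open Scope classical_set_scope.
Variables (R : realType) (X : R).
Hypothesis X0 : 0 < X.
Local Notation mu := (@lebesgue_measure R).
Local Notation I := (`[0, X] : set R).
Local Notation rint h := (Rintegral mu I h).
Definition rintegrable (u : R -> R) := mu.-integrable I (EFin \o u).

Lemma rintegrable_cst a : rintegrable (fun=> a).
Proof.
apply: continuous_compact_integrable; first exact: segment_compact.
by apply: continuous_subspaceT => x; exact: cvg_cst.
Qed.

Lemma rintegrable_lin a u v :
  rintegrable u -> rintegrable v -> rintegrable (fun x => u x + a * v x).
Proof.
move=> iu iv.
apply: (@integrableD _ _ _ mu I _ (EFin \o u) (fun x => a%:E * (EFin \o v) x)%E) => //.
exact: integrableZl.
Qed.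

Lemma rintegrable_mul u h : rintegrable u -> continuous h -> (forall x, `|h x| <= 1) ->
  rintegrable (fun x => u x * h x).
Proof.
move=> iu ch h1; apply: (@integrableMl _ _ _ mu I _ (EFin \o u) h) => //.
- exact: measurable_funTS (continuous_measurable_fun ch).
- exists 1; split; rewrite ?num_real // => M M1 x _.
  exact: le_trans (h1 x) (ltW M1).
Qed.

Variable k : int.
Definition cosint (u : R -> R) := rint (fun x => u x * cos (xi X k * x)).
Definition sinint (u : R -> R) := rint (fun x => u x * sin (xi X k * x)).

Lemma continuous_lin (a : R) : continuous (fun x : R => a * x).
Proof. by move=> x; apply: cvgM; [exact: cvg_cst|exact: cvg_id]. Qed.

Lemma continuous_cos_xi : continuous (fun x => cos (xi X k * x)).
Proof.
by move=> x; apply: continuous_comp; [exact: continuous_lin|exact: continuous_cos].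
Qed.

Lemma continuous_sin_xi : continuous (fun x => sin (xi X k * x)).
Proof.
by move=> x; apply: continuous_comp; [exact: continuous_lin|exact: continuous_sin].
Qed.

Lemma rintegrable_cos u : rintegrable u -> rintegrable (fun x => u x * cos (xi X k * x)).
Proof.
move=> iu; apply: rintegrable_mul => //; first exact: continuous_cos_xi.
by move=> x; rewrite ler_norml cos_geN1 cos_le1.
Qed.

Lemma rintegrable_sin u : rintegrable u -> rintegrable (fun x => u x * sin (xi X k * x)).
Proof.
by move=> iu; apply: rintegrable_mul => //; [exact: continuous_sin_xi|move=> x; exact: sin_max].
Qed.

Lemma rint_lin a u v : rintegrable u -> rintegrable v ->
  rint (fun x => u x + a * v x) = rint u + a * rint v.
Proof.
move=> iu iv; rewrite (@RintegralD _ _ _ mu I u (fun x => a * v x)) //.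
  by rewrite RintegralZl.
by apply: (@integrableZl _ _ _ mu I _ a (EFin \o v)).
Qed.

Lemma cosint_lin a u v : rintegrable u -> rintegrable v ->
  cosint (fun x => u x + a * v x) = cosint u + a * cosint v.
Proof.
move=> iu iv; rewrite /cosint -rint_lin; [|exact: rintegrable_cos|exact: rintegrable_cos].
by apply: eq_Rintegral => x _; ring.
Qed.

Lemma sinint_lin a u v : rintegrable u -> rintegrable v ->
  sinint (fun x => u x + a * v x) = sinint u + a * sinint v.
Proof.
move=> iu iv; rewrite /sinint -rint_lin; [|exact: rintegrable_sin|exact: rintegrable_sin].
by apply: eq_Rintegral => x _; ring.
Qed.

Definition cintegrable (f : R -> R[i]) :=
  rintegrable (fun x => complex.Re (f x)) /\ rintegrable (fun x => complex.Im (f x)).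

(** Integrability allows each defining integral to be split, so a coefficient is expressed by real
    functionals linear in [u] and [v]. *)
Lemma fcoefE f : cintegrable f ->
  let u := fun x => complex.Re (f x) in let v := fun x => complex.Im (f x) in
  fcoef X f k = Complex (X^-1 * (cosint u + sinint v)) (X^-1 * (cosint v - sinint u)).
Proof.
move=> [iu iv] u v; rewrite /fcoef; congr Complex; congr (_ * _).
  rewrite -(mul1r (sinint v)) -rint_lin; [|exact: rintegrable_cos|exact: rintegrable_sin].
  by apply: eq_Rintegral => x _; rewrite mul1r.
rewrite -mulN1r -rint_lin; [|exact: rintegrable_cos|exact: rintegrable_sin].
by apply: eq_Rintegral => x _; rewrite mulN1r.
Qed.

Lemma cintegrable_lin f g z :
  cintegrable f -> cintegrable g -> cintegrable (fun x => f x + z * g x).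
Proof.
move=> [f1 f2] [g1 g2]; split.
  rewrite (_ : (fun x => _) = fun x => (complex.Re (f x) + complex.Re z * complex.Re (g x))
     + (- complex.Im z) * complex.Im (g x)).
    by apply: rintegrable_lin => //; exact: rintegrable_lin.
  by apply/funext => x; case: (f x) (g x) z => [a b] [c d] [p q] /=; ring.
rewrite (_ : (fun x => _) = fun x => (complex.Im (f x) + complex.Re z * complex.Im (g x))
     + complex.Im z * complex.Re (g x)).
  by apply: rintegrable_lin => //; exact: rintegrable_lin.
by apply/funext => x; case: (f x) (g x) z => [a b] [c d] [p q] /=; ring.
Qed.

Lemma cintegrable_cst z : cintegrable (fun=> z).
Proof. by split; exact: rintegrable_cst. Qed.

Lemma fcoef_lin f g z : cintegrable f -> cintegrable g ->
  fcoef X (fun x => f x + z * g x) k = fcoef X f k + z * fcoef X g k.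
Proof.
move=> hf hg; rewrite (fcoefE (cintegrable_lin z hf hg)) (fcoefE hf) (fcoefE hg).
case: hf hg => [f1 f2] [g1 g2].
have -> : (fun x => complex.Re (f x + z * g x)) = fun x =>
    (complex.Re (f x) + complex.Re z * complex.Re (g x)) + (- complex.Im z) * complex.Im (g x).
  by apply/funext => x; case: (f x) (g x) z => [a b] [c d] [p q] /=; ring.
have -> : (fun x => complex.Im (f x + z * g x)) = fun x =>
    (complex.Im (f x) + complex.Re z * complex.Im (g x)) + complex.Im z * complex.Re (g x).
  by apply/funext => x; case: (f x) (g x) z => [a b] [c d] [p q] /=; ring.
rewrite !cosint_lin ?sinint_lin //; try exact: rintegrable_lin.
case: z => p q; apply/eqP; rewrite eq_complex /=.
by apply/andP; split; apply/eqP; ring.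
Qed.

Lemma xi_X : xi X k * X = 2 * pi * k%:~R.
Proof. by rewrite /xi mulfVK // gt_eqF. Qed.

Lemma sin_2pi_int (m : int) : sin (2 * pi * m%:~R : R) = 0 /\ cos (2 * pi * m%:~R : R) = 1.
Proof.
have h (j : nat) : sin (2 * pi * j%:R : R) = 0 /\ cos (2 * pi * j%:R : R) = 1.
  have -> : 2 * pi * j%:R = 0 + pi *+ 2 *+ j :> R.
    by rewrite add0r mulr_natr mulr_natl.
  by split; rewrite (periodicn (@sinD2pi R), periodicn (@cosD2pi R)) ?sin0 ?cos0.
case: m => j; first by rewrite -pmulrn; exact: h.
rewrite NegzE rmorphN /= mulrN sinN cosN -pmulrn.
by have [-> ->] := h j.+1; rewrite oppr0.
Qed.

Lemma xi_neq0 : k != 0 -> xi X k != 0.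
Proof.
by move=> k0; rewrite /xi !mulf_neq0 ?invr_eq0 ?intr_eq0 ?(gt_eqF X0) // gt_eqF // pi_gt0.
Qed.

Lemma rint_FTC (F f : R -> R) : continuous f ->
  (forall x : R, is_derive x 1 F (f x)) -> rint f = F X - F 0.
Proof.
move=> cf dF; rewrite /Rintegral (@continuous_FTC2 _ f F 0 X) //.
- exact: continuous_subspaceT.
- have cF : continuous F.
    by move=> x; apply/differentiable_continuous/derivable1_diffP; case: (dF x).
  split.
  + by move=> x _; case: (dF x).
  + by apply: cvg_at_right_filter; exact: cF.
  + by apply: cvg_at_left_filter; exact: cF.
- by move=> x _; rewrite derive1E; case: (dF x).
Qed.

(** The antiderivative [sin (xi x) / xi] vanishes at both ends, since [xi X] is a multiple of
    [2 pi]. *)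
Lemma rint_cos : k != 0 -> rint (fun x => cos (xi X k * x)) = 0.
Proof.
move=> /xi_neq0 x0.
have d (x : R) : is_derive x 1 (fun x => (xi X k)^-1 * sin (xi X k * x)) (cos (xi X k * x)).
  by rewrite -[cos _](mulKf x0); apply: is_derive_scale; exact: is_derive_sin.
rewrite (rint_FTC continuous_cos_xi d).
by rewrite xi_X mulr0 sin0 (sin_2pi_int k).1 subrr.
Qed.

Lemma rint_sin : k != 0 -> rint (fun x => sin (xi X k * x)) = 0.
Proof.
move=> /xi_neq0 x0.
have d (x : R) : is_derive x 1 (fun x => - (xi X k)^-1 * cos (xi X k * x)) (sin (xi X k * x)).
  by rewrite -[sin _]opprK -[- sin _](mulKf x0) -mulNr;
    apply: is_derive_scale; exact: is_derive_cos.
rewrite (rint_FTC continuous_sin_xi d).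
by rewrite xi_X mulr0 cos0 (sin_2pi_int k).2 subrr.
Qed.

Lemma cosint_cst a : cosint (fun=> a) = (k == 0)%:R * (a * X).
Proof.
rewrite /cosint RintegralZl; last 2 first.
- exact: measurable_itv.
- suff -> : (fun x => cos (xi X k * x)) = (fun x => 1 * cos (xi X k * x)).
    exact: (rintegrable_cos (rintegrable_cst 1)).
  by apply/funext => x; rewrite mul1r.
have [k0|k0] := eqVneq k 0; last by rewrite rint_cos // mulr0 mul0r.
rewrite mul1r; congr (_ * _).
rewrite (@eq_Rintegral _ _ _ mu I (fun=> 1)); last first.
  by move=> x _; rewrite k0 /xi mulr0 !mul0r cos0.
rewrite Rintegral_cst ?mul1r; last exact: measurable_itv.
have := lebesgue_measure_itv (`[0, X]%R : interval R); rewrite /= lte_fin X0 => e.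
by rewrite [mu _]e /= subr0.
Qed.

Lemma sinint_cst a : sinint (fun=> a) = 0.
Proof.
rewrite /sinint RintegralZl; last 2 first.
- exact: measurable_itv.
- suff -> : (fun x => sin (xi X k * x)) = (fun x => 1 * sin (xi X k * x)).
    exact: (rintegrable_sin (rintegrable_cst 1)).
  by apply/funext => x; rewrite mul1r.
have [k0|k0] := eqVneq k 0; last by rewrite rint_sin // mulr0.
rewrite (@eq_Rintegral _ _ _ mu I (fun=> 0)); last first.
  by move=> x _; rewrite k0 /xi mulr0 !mul0r sin0.
by rewrite Rintegral_cst ?mul0r ?mulr0; last exact: measurable_itv.
Qed.

(** Consequently the scalar terms in [sigma] and [lambda] affect only the blocks [k = m]. *)
Lemma fcoef_cst z : fcoef X (fun=> z) k = z * (k == 0)%:R.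
Proof.
rewrite (fcoefE (cintegrable_cst z)) !cosint_cst !sinint_cst.
case: z => a b; case: eqP => _; apply/eqP; rewrite eq_complex /=;
  apply/andP; split; apply/eqP; field; exact: lt0r_neq0.
Qed.
End Fourier.

(** * The symbol of the operator *)

Section Symbols.
Variables (R : realType) (X : R).
Implicit Types k m : int.

(** Symbol of [1 - d^2/dx^2]: both the weight of the [H^1] norm and the inverse modulus of the
    resolvent symbol. *)
Definition weight k : R := 1 + xi X k ^+ 2.

Lemma weight_ge1 k : 1 <= weight k.
Proof. by rewrite lerDl sqr_ge0. Qed.

Lemma weight_gt0 k : 0 < weight k.
Proof. exact: lt_le_trans (weight_ge1 k). Qed.

Lemma xiB k m : xi X (k - m) = xi X k - xi X m.
Proof. by rewrite /xi rmorphB /= mulrBr mulrBl. Qed.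

Lemma xi0 : xi X 0 = 0.
Proof. by rewrite /xi mulr0 mul0r. Qed.

Lemma weightN k : weight (- k) = weight k.
Proof. by rewrite /weight -(sub0r k) xiB xi0 sub0r sqrrN. Qed.

(** With [b = xi m] and [c = xi (k - m)], the two sides differ by [(c - b)^2 + 1 + 2 (b c)^2]. *)
Lemma weight_peetre k m : weight k <= 2 * weight m * weight (k - m).
Proof.
rewrite /weight xiB; move: (xi X k) (xi X m) => a b.
have : 0 <= (a - b - b) ^+ 2 + 1 + 2 * (b * (a - b)) ^+ 2.
  by rewrite !addr_ge0 ?sqr_ge0 // mulr_ge0 ?sqr_ge0.
by rewrite !expr2; lra.
Qed.

Lemma weight_ge_sqr k : (2 * pi / X) ^+ 2 * k%:~R ^+ 2 <= weight k.
Proof. by rewrite -exprMn mulrAC lerDr. Qed.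

Lemma cabs_sym_res k : cabs (sym_res X k) = (weight k)^-1.
Proof.
rewrite /sym_res cabsV; congr (_^-1).
have -> : sym_dx X k ^+ 2 - 1 = ((- weight k)%:C)%C.
  by apply/eqP; rewrite eq_complex /= /weight !expr2; apply/andP; split; apply/eqP; ring.
by rewrite cabs_real normrN ger0_norm // ltW // weight_gt0.
Qed.

Lemma cabs_sym_dx k : cabs (sym_dx X k) = `|xi X k|.
Proof. by rewrite /cabs /= expr0n add0r sqrtr_sqr. Qed.

(** Cauchy-Schwarz gives [(|xi| |z1| + |z0|)^2 <= (1 + xi^2) (|z1|^2 + |z0|^2)]; the derivative thus
    uses up one of the two inverse weights of the squared resolvent. *)
Lemma cabs_sym_comb k (z1 z0 : R[i]) :
  cabs (sym_dx X k * sym_res X k * z1 + sym_res X k * z0) ^+ 2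
    <= (cabs z1 ^+ 2 + cabs z0 ^+ 2) / weight k.
Proof.
have w0 := weight_gt0 k.
have -> : sym_dx X k * sym_res X k * z1 + sym_res X k * z0 =
  sym_res X k * (sym_dx X k * z1 + z0) by ring.
rewrite cabsM exprMn cabs_sym_res expr2 -mulrA mulrC ler_pM2r ?invr_gt0 //.
rewrite ler_pdivrMl //.
have h := cabsD (sym_dx X k * z1) z0; rewrite cabsM cabs_sym_dx in h.
apply: (@le_trans _ _ ((`|xi X k| * cabs z1 + cabs z0) ^+ 2)).
  by rewrite ler_sqr ?nnegrE ?cabs_ge0 // addr_ge0 ?mulr_ge0 ?cabs_ge0.
rewrite /weight -(real_normK (num_real (xi X k))).
move: `|xi X k| (cabs z1) (cabs z0) => a b c.
have : 0 <= (b - a * c) ^+ 2 by exact: sqr_ge0.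
by rewrite !expr2; lra.
Qed.
End Symbols.

(** * Entry bounds for [K], uniform in [sigma] and [lambda] *)

Section Entries.
Variables (R : realType) (n : nat) (X : R) (a0 a1 : R -> 'M[R[i]]_n).
Hypotheses (X0 : 0 < X) (h0 : H1per_mx X a0) (h1 : H1per_mx X a1).

Lemma H1per_cintegrable (f : R -> R[i]) : H1per X f -> cintegrable X f.
Proof. by case. Qed.

Lemma fcoef_A1 s i j l : fcoef X (fun x => A1 a1 s x i j) l =
  fcoef X (fun x => a1 x i j) l + (2 * 'i * Complex s 0) *+ (i == j) * (l == 0)%:R.
Proof.
have -> : (fun x => A1 a1 s x i j) =
    fun x => a1 x i j + 1 * ((2 * 'i * Complex s 0) *+ (i == j)).
  by apply/funext => x; rewrite /A1 !mxE mul1r.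
by rewrite fcoef_lin ?fcoef_cst ?mul1r //; [exact: H1per_cintegrable|exact: cintegrable_cst].
Qed.

Lemma fcoef_A0 s lam i j l :
  fcoef X (fun x => (A0 a0 a1 s x + (1 - lam)%:M) i j) l =
  fcoef X (fun x => a0 x i j) l + ('i * Complex s 0) * fcoef X (fun x => a1 x i j) l
  + (1 - lam - Complex s 0 ^+ 2) *+ (i == j) * (l == 0)%:R.
Proof.
have c01 := cintegrable_lin ('i * Complex s 0) (H1per_cintegrable (h0 i j))
  (H1per_cintegrable (h1 i j)).
have -> : (fun x => (A0 a0 a1 s x + (1 - lam)%:M) i j) =
    fun x => (a0 x i j + 'i * Complex s 0 * a1 x i j)
      + 1 * ((1 - lam - Complex s 0 ^+ 2) *+ (i == j)).
  apply/funext => x; rewrite /A0 !mxE.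
  by case: (i == j); rewrite /= ?mulr1n ?mulr0n; ring.
rewrite fcoef_lin ?fcoef_cst ?mul1r //; last exact: cintegrable_cst.
by rewrite fcoef_lin //; exact: H1per_cintegrable.
Qed.

(** Independent of [sigma] and [lambda]; the term at [l = 0] absorbs the scalar multiples of the
    identity that carry them. *)
Definition fmass (l : int) : R :=
  \sum_(ij : 'I_n * 'I_n) (cabs (fcoef X (fun x => a0 x ij.1 ij.2) l) ^+ 2
                       + cabs (fcoef X (fun x => a1 x ij.1 ij.2) l) ^+ 2)
  + (l == 0)%:R.

Lemma fmass_ge0 l : 0 <= fmass l.
Proof.
by rewrite addr_ge0 //; apply: sumr_ge0 => ij _; rewrite addr_ge0 ?sqr_ge0.
Qed.

Lemma fmass_bounded : exists M : R, 0 <= M /\ forall J : nat,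
  \sum_(p < 2 * J + 1) weight X (idxJ p) * fmass (idxJ p) <= M.
Proof.
pose P (a : R -> 'M[R[i]]_n) (ij : 'I_n * 'I_n) M := forall J : nat,
  \sum_(p < 2 * J + 1)
    weight X (idxJ p) * cabs (fcoef X (fun x => a x ij.1 ij.2) (idxJ p)) ^+ 2 <= M.
have /boolp.choice[M0 hM0] : forall ij, exists M, P a0 ij M.
  by move=> ij; case: (h0 ij.1 ij.2).
have /boolp.choice[M1 hM1] : forall ij, exists M, P a1 ij M.
  by move=> ij; case: (h1 ij.1 ij.2).
have hM J : \sum_(p < 2 * J + 1) weight X (idxJ p) * fmass (idxJ p) <=
    \sum_ij (M0 ij + M1 ij) + 1.
  rewrite /fmass; under eq_bigr do rewrite mulrDr mulr_sumr.
  rewrite big_split /= exchange_big /=; apply: lerD.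
    apply: ler_sum => ij _; under eq_bigr do rewrite mulrDr.
    by rewrite big_split /=; apply: lerD; [exact: hM0|exact: hM1].
  (* Frequency 0 is the position [p = J], where the weight is 1: hence the summand 1. *)
  have pJ : (J < 2 * J + 1)%N by lia.
  rewrite (bigD1 (Ordinal pJ)) //= big1 => [|p /negPf pn].
    by rewrite /idxJ /= subrr eqxx mulr1 addr0 /weight xi0 expr0n addr0.
  case: eqP; rewrite ?mulr0 // /idxJ => e; move: pn; rewrite -val_eqE /=; lia.
exists (\sum_ij (M0 ij + M1 ij) + 1); split=> //; apply: le_trans (hM 0%N).
apply: sumr_ge0 => p _; rewrite mulr_ge0 ?fmass_ge0 //; exact: ltW (weight_gt0 X _).
Qed.

Lemma cabs_delta_le (z : R[i]) (b b' : bool) (P : R) :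
  cabs z <= P -> cabs (z *+ b * b'%:R) <= P * b'%:R.
Proof.
have z0 := cabs_ge0 z.
case: b; case: b'; rewrite ?mulr1n ?mulr0n ?mulr0 ?mul0r ?mulr1 ?cabs0 //.
exact: le_trans.
Qed.

(** [P] dominates [s], [2 s] and [|1 - lam - s^2|]. The factor 5 comes from squaring a sum of two
    terms and a sum of three, each containing [P] times the Kronecker delta: 2 + 3. *)
Lemma Kentry_le (s Rad P : R) (lam : R[i]) x y :
  0 <= s < 2 * pi -> cabs lam <= Rad ->
  P = 2 * (2 * pi) + (2 * pi) ^+ 2 + 1 + Rad ->
  cabs (Kentry X a0 a1 s lam x y) ^+ 2 <=
    5 * (1 + P ^+ 2) * fmass (x.1 - y.1) / weight X x.1.
Proof.
case: x y => [k i] [m j] /andP[s0 s1] hl hP; rewrite [(k, i).1]/= [(m, j).1]/=.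
apply: le_trans (@cabs_sym_comb _ X k _ _) _.
rewrite ler_pM2r ?invr_gt0 ?weight_gt0 // fcoef_A1 fcoef_A0.
move: (k - m) => l.
have L0 := cabs_ge0 lam.
have ps : s ^+ 2 <= (2 * pi) ^+ 2 by rewrite ler_sqr ?nnegrE // ?(le_trans s0) // ltW.
have sP : s <= P by rewrite hP; have := sqr_ge0 (2 * pi : R); lra.
have ss : cabs (Complex s 0) = s by rewrite cabs_real ger0_norm.
have ci : cabs ('i : R[i]) = 1.
  by rewrite /cabs /= expr0n add0r expr1n sqrtr1.
have c2 : cabs (2 : R[i]) = 2.
  by rewrite -[2]/(2%:R) -(rmorph_nat (@real_complex R)) cabs_real ger0_norm.
have z1 : cabs ((2 * 'i * Complex s 0) *+ (i == j) * (l == 0)%:R : R[i]) <= P * (l == 0)%:R.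
  apply: cabs_delta_le; rewrite !cabsM ci ss c2 mulr1 hP.
  by have := sqr_ge0 (2 * pi : R); lra.
have z0 : cabs ((1 - lam - Complex s 0 ^+ 2) *+ (i == j) * (l == 0)%:R : R[i]) <= P * (l == 0)%:R.
  apply: cabs_delta_le; apply: le_trans (cabsB _ _) _.
  rewrite [in leLHS]expr2 cabsM ss -expr2.
  by have := cabsB 1 lam; rewrite cabs1 hP; lra.
have hm : cabs (fcoef X (fun x => a0 x i j) l) ^+ 2 + cabs (fcoef X (fun x => a1 x i j) l) ^+ 2
   + (l == 0)%:R <= fmass l.
  rewrite /fmass lerD2r (bigD1 (i, j)) //= lerDl.
  by apply: sumr_ge0 => ij _; rewrite addr_ge0 ?sqr_ge0.
apply: (le_trans _ (ler_wpM2l _ hm)); last by rewrite mulr_ge0 ?addr_ge0 ?sqr_ge0.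
move: z1 z0; move: (_ * (l == 0)%:R : R[i]) => e1; move: (_ * (l == 0)%:R : R[i]) => e0 z1 z0.
(* The delta is its own square, which makes the final inequality a purely quadratic one. *)
have d2 : (l == 0)%:R ^+ 2 = (l == 0)%:R :> R by case: (l == 0); rewrite ?expr1n ?expr0n.
rewrite -{}d2; move: ((l == 0)%:R : R) (ler0n R (l == 0)) z1 z0 => d d0 z1 z0.
move: (fcoef X (fun x => a0 x i j) l) (fcoef X (fun x => a1 x i j) l) => f0 f1.
have b1 : cabs (f1 + e1) <= cabs f1 + P * d.
  by apply: le_trans (cabsD _ _) _; rewrite lerD2l.
have b0 : cabs (f0 + 'i * Complex s 0 * f1 + e0) <= cabs f0 + P * cabs f1 + P * d.
  apply: le_trans (cabsD _ _) _; apply: lerD z0.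
  apply: le_trans (cabsD _ _) _; rewrite lerD2l !cabsM ci ss mul1r.
  by rewrite ler_wpM2r // cabs_ge0.
apply: (@le_trans _ _ ((cabs f1 + P * d) ^+ 2 + (cabs f0 + P * cabs f1 + P * d) ^+ 2)).
  have u1 := le_trans (cabs_ge0 _) b1; have u0 := le_trans (cabs_ge0 _) b0.
  by apply: lerD; rewrite ler_sqr ?nnegrE ?cabs_ge0.
move: (cabs f0) (cabs f1) => B A.
have := sqr_ge0 (A - P * d); have := sqr_ge0 (B - P * A).
have := sqr_ge0 (B - P * d); have := sqr_ge0 (P * A - P * d).
have := sqr_ge0 A; have := sqr_ge0 B; have := sqr_ge0 d.
have := sqr_ge0 (P * A); have := sqr_ge0 (P * B).
by rewrite !expr2; lra.
Qed.
End Entries.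

Theorem theorem3p10 (R : realType) (n : nat) (X : R) (a0 a1 : R -> 'M[R[i]]_n) :
  0 < X -> (1 <= n)%N -> H1per_mx X a0 -> H1per_mx X a1 ->
  forall Rad : R, 0 < Rad ->
  exists C : R, 0 < C /\
    forall (s : R) (lam : R[i]), 0 <= s < 2 * pi -> cabs lam <= Rad ->
      exists D : R[i], is_det2_Iplus (Kentry X a0 a1 s lam) D /\
        forall J : nat, (1 <= J)%N ->
          cabs (@det2_trunc _ _ J (Kentry X a0 a1 s lam) - D) <= C / Num.sqrt J%:R.
Proof.
move=> X0 _ h0 h1 Rad Rad0.
have [M [M0 hM]] := fmass_bounded X0 h0 h1.
pose P : R := 2 * (2 * pi) + (2 * pi) ^+ 2 + 1 + Rad.
have q0 : 0 <= 5 * (1 + P ^+ 2) by rewrite mulr_ge0 // addr_ge0 // sqr_ge0.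
have g0 : 0 < (2 * pi / X) ^+ 2 by rewrite exprn_gt0 // divr_gt0 // mulr_gt0 // pi_gt0.
have [C [C0 hC]] := det2_trunc_rate n (mulr_ge0 q0 M0) g0.
exists C; split=> // s lam hs hl.
(* Neither weight nor mass depends on [s] or [lam]; only [K] does. *)
have [J|x y|D [hD rD]] := hC (weight X) (fun l => 5 * (1 + P ^+ 2) * fmass X a0 a1 l)
  (Kentry X a0 a1 s lam) (weight_ge1 X) (weightN X) (weight_peetre X)
  (weight_ge_sqr X) (fun k => mulr_ge0 q0 (fmass_ge0 X a0 a1 k)).
- rewrite (eq_bigr (fun p => 5 * (1 + P ^+ 2) * (weight X (idxJ p) * fmass X a0 a1 (idxJ p)))).
    by rewrite -mulr_sumr ler_wpM2l // hM.
  by move=> p _; rewrite mulrCA.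
- exact: (Kentry_le X0 h0 h1 x y hs hl).
exists D; split=> // J J1; apply: le_trans (rD J) _.
(* The rate [1 / (J + 1)] implies the claimed one, as [J <= J + 1 <= (J + 1)^2]. *)
have J0 : 0 < Num.sqrt (J%:R : R) by rewrite sqrtr_gt0 ltr0n.
rewrite ler_pM2l // lef_pV2 ?posrE //.
rewrite -ler_sqr ?nnegrE ?(ltW J0) // sqr_sqrtr //.
rewrite (le_trans (_ : _ <= J.+1%:R)) ?ler_nat // expr2 ler_peMl ?ler1n //.
Qed.
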